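(* Let $R$ be a regular commutative coherent ring, let $\mathcal{C}$ be a wide subcategory of finitely presented $R$-modules, and let $M\in\mathcal{C}$. If $N$ is a finitely presented submodule or a finitely presented quotient module of $M$, then $N\in\mathcal{C}$. In particular, if $R$ is also Noetherian, every wide subcategory of finitely generated $R$-modules is a Serre class.
   Context: A commutative ring is coherent if every finitely generated ideal is finitely presented; a coherent ring is regular if every finitely presented module has finite projective dimension. A full subcategory $\mathcal{C}$ of an abelian category is called wide if it is closed under kernels and cokernels of its maps and under extensions. A wide subcategory of finitely presented (respectively finitely generated) $R$-modules is a wide subcategory of the category of $R$-modules all of whose objects are finitely presented (respectively finitely generated). A Serre class is a wide subcategory closed under arbitrary subobjects (and hence arbitrary quotient objects). *)

(* Defs.v *)
From HB Require Import structures.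
From mathcomp Require Import all_boot all_order all_algebra.

Set Implicit Arguments.
Unset Strict Implicit.
Unset Printing Implicit Defensive.

Import GRing.Theory.
Local Open Scope ring_scope.

(* comPzRingType: the zero ring is allowed. Submodules, quotient modules,
   kernels and cokernels are given up to isomorphism, as a module together
   with an injective or surjective linear map. Thus every class of modules
   closed under kernels or cokernels is closed under isomorphism.           *)

Definition surjective (A B : Type) (f : A -> B) : Prop :=
  forall y, exists x, f x = y.

Section Modules.

Variable R : comPzRingType.

Definition exact_at (A B C : lmodType R)
    (f : {linear A -> B}) (g : {linear B -> C}) : Prop :=
  forall y, g y = 0 <-> exists x, f x = y.

Definition is_submodule (N M : lmodType R) : Prop :=
  exists i : {linear N -> M}, injective i.

Definition is_quotient (N M : lmodType R) : Prop :=
  exists p : {linear M -> N}, surjective p.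

Definition is_kernel (A B K : lmodType R)
    (f : {linear A -> B}) (i : {linear K -> A}) : Prop :=
  injective i /\ exact_at i f.

Definition is_cokernel (A B Q : lmodType R)
    (f : {linear A -> B}) (p : {linear B -> Q}) : Prop :=
  surjective p /\ exact_at f p.

Definition short_exact (A E B : lmodType R)
    (i : {linear A -> E}) (p : {linear E -> B}) : Prop :=
  [/\ injective i, exact_at i p & surjective p].

Definition finitely_generated (M : lmodType R) : Prop :=
  exists n, exists p : {linear 'rV[R]_n -> M}, surjective p.

Definition finitely_presented (M : lmodType R) : Prop :=
  exists m n, exists (f : {linear 'rV[R]_m -> 'rV[R]_n})
                     (p : {linear 'rV[R]_n -> M}),
    exact_at f p /\ surjective p.

Definition projective (P : lmodType R) : Prop :=
  forall (A B : lmodType R) (g : {linear A -> B}) (h : {linear P -> B}),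
    surjective g -> exists k : {linear P -> A}, forall x, g (k x) = h x.

Definition projective_resolution (M : lmodType R) (P : nat -> lmodType R)
    (d : forall i, {linear P i.+1 -> P i}) (e : {linear P 0 -> M}) : Prop :=
  [/\ forall i, projective (P i),
      surjective e,
      exact_at (d 0) e
    & forall i, exact_at (d i.+1) (d i)].

Definition finite_projective_dimension (M : lmodType R) : Prop :=
  exists (n : nat) (P : nat -> lmodType R)
         (d : forall i, {linear P i.+1 -> P i}) (e : {linear P 0 -> M}),
    projective_resolution d e
    /\ forall i, (n < i)%N -> forall x : P i, x = 0.

Definition is_ideal (I : lmodType R) : Prop := is_submodule I R^o.

Definition coherent : Prop :=
  forall I : lmodType R,
    is_ideal I -> finitely_generated I -> finitely_presented I.

Definition regular_coherent : Prop :=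
  coherent /\
  forall M : lmodType R,
    finitely_presented M -> finite_projective_dimension M.

Definition noetherian : Prop :=
  forall I : lmodType R, is_ideal I -> finitely_generated I.

(* A full subcategory is given by the class of its objects. *)
Record wide (C : lmodType R -> Prop) : Prop := Wide {
  wide_kernel : forall (A B K : lmodType R)
      (f : {linear A -> B}) (i : {linear K -> A}),
    C A -> C B -> is_kernel f i -> C K;
  wide_cokernel : forall (A B Q : lmodType R)
      (f : {linear A -> B}) (p : {linear B -> Q}),
    C A -> C B -> is_cokernel f p -> C Q;
  wide_extension : forall (A E B : lmodType R)
      (i : {linear A -> E}) (p : {linear E -> B}),
    C A -> C B -> short_exact i p -> C E
}.

Definition serre (C : lmodType R -> Prop) : Prop :=
  wide C /\ forall M N : lmodType R, C M -> is_submodule N M -> C N.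

End Modules.

Arguments coherent R : clear implicits.
Arguments regular_coherent R : clear implicits.
Arguments noetherian R : clear implicits.

(* Main.v *)
Require Import Defs.
From HB Require Import structures.
From mathcomp Require Import all_boot all_order all_algebra.
From mathcomp Require Import boolp.

Set Implicit Arguments.
Unset Strict Implicit.
Unset Printing Implicit Defensive.

Import GRing.Theory.
Local Open Scope ring_scope.
Local Open Scope quotient_scope.

(* Call a finite list P of scalars good if every finitely presented module
   killed by P lies in C. Good lists are closed under products, and if Z = R z
   lies in C then generators of ann z are good. A finitely presented submodule
   or quotient of M is killed by whatever kills M, so it suffices to find a good
   P with P M = 0. Starting from P = {1}, one keeps P M inside the span of a set
   of generators of M and removes these generators one at a time, replacing P by
   P J P for a suitable good J. Over a Noetherian ring, finitely generated
   modules are finitely presented.                                           *)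

(** * Submodules and quotient modules cut out by predicates *)

Definition submodule_pred (R : comPzRingType) (V : lmodType R)
    (U : V -> Prop) : Prop :=
  U 0 /\ forall a x y, U x -> U y -> U (a *: x + y).

Definition to_linear (R : comPzRingType) (A B : lmodType R) (f : A -> B)
    (f_lin : linear f) : {linear A -> B} :=
  HB.pack f (GRing.isLinear.Build R A B *:%R f f_lin).

Section SubQuotient.

Variables (R : comPzRingType) (V : lmodType R) (U : V -> Prop).
Hypothesis U_sub : submodule_pred U.

(** Classical reflection turns the [Prop]-valued [U] into a boolean predicate, as the subtype and
    quotient structures require. *)
Definition submodule_mem : {pred V} := fun x => `[< U x >].

Lemma submodule_mem_closed : submod_closed submodule_mem.
Proof.
case: U_sub => U0 UP; split; first exact/asboolP.
by move=> a x y /asboolP Ux /asboolP Uy; apply/asboolP; apply: UP.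
Qed.

HB.instance Definition _ :=
  GRing.isSubmodClosed.Build R V submodule_mem submodule_mem_closed.

Definition submodule_type := {x : V | submodule_mem x}.

HB.instance Definition _ := SubChoice.on submodule_type.
HB.instance Definition _ := [SubChoice_isSubLmodule of submodule_type by <:].

Lemma submodule_exists :
  exists (W : lmodType R) (i : {linear W -> V}),
    injective i /\ forall v, U v <-> exists w, i w = v.
Proof.
exists submodule_type, (val : {linear submodule_type -> V}); split.
  exact: val_inj.
move=> v; split=> [Uv|[[w Uw] <-]]; last exact/asboolP.
by exists (exist _ v (asboolT Uv)).
Qed.

Definition quotient_type := @Quotient.quot V submodule_mem.

HB.instance Definition _ :
    EqQuotient V (Quotient.equiv submodule_mem) quotient_type :=
  EqQuotient.on quotient_type.
HB.instance Definition _ := GRing.Zmodule.on quotient_type.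

(** Scaling acts on a chosen representative; [pi_scale] shows that the choice does not matter. *)
Definition quotient_scale (a : R) (x : quotient_type) : quotient_type :=
  \pi_quotient_type (a *: repr x).

Lemma quotient_piE (x y : V) :
  (\pi_quotient_type x = \pi_quotient_type y :> quotient_type) <-> U (x - y).
Proof.
split=> [/eqP|Uxy].
  by rewrite -Quotient.idealrBE => /asboolP.
by apply/eqP; rewrite -Quotient.idealrBE; apply/asboolP.
Qed.

Lemma pi_scale a x :
  quotient_scale a (\pi_quotient_type x) = \pi_quotient_type (a *: x).
Proof.
apply/quotient_piE; rewrite -scalerBr.
case: U_sub => U0 UP; rewrite -[_ *: _]addr0; apply: UP => //.
by apply/quotient_piE; rewrite reprK.
Qed.

Lemma pi_add x y :
  (\pi_quotient_type x + \pi_quotient_type y : quotient_type) =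
  \pi_quotient_type (x + y).
Proof. by rewrite !piE. Qed.

Lemma quotient_scaleA a b v :
  quotient_scale a (quotient_scale b v) = quotient_scale (a * b) v.
Proof. by rewrite -[v]reprK !pi_scale scalerA reprK. Qed.

Lemma quotient_scale1 : left_id 1 quotient_scale.
Proof. by move=> v; rewrite -[v]reprK !pi_scale scale1r. Qed.

Lemma quotient_scaleDr : right_distributive quotient_scale +%R.
Proof.
move=> a v w; rewrite -[v]reprK -[w]reprK pi_add !pi_scale pi_add.
by rewrite scalerDr.
Qed.

Lemma quotient_scaleDl v : {morph quotient_scale^~ v : a b / a + b}.
Proof. by move=> a b; rewrite -[v]reprK !pi_scale pi_add scalerDl. Qed.

HB.instance Definition _ := GRing.Zmodule_isLmodule.Build R quotient_type
  quotient_scaleA quotient_scale1 quotient_scaleDr quotient_scaleDl.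

Lemma quotient_exists :
  exists (Q : lmodType R) (p : {linear V -> Q}),
    surjective p /\ forall v, p v = 0 <-> U v.
Proof.
have pi_lin : linear \pi_quotient_type.
  by move=> a x y; rewrite -pi_add -pi_scale.
exists quotient_type, (to_linear pi_lin); split=> [y|v] /=.
  by exists (repr y); rewrite /= reprK.
rewrite -[X in U X]subr0 -quotient_piE.
suff -> : (\pi_quotient_type 0 : quotient_type) = 0 by [].
by rewrite piE.
Qed.

End SubQuotient.

(** * Linear maps from graphs, images, kernels, cokernels, and maps out of R^n *)

Section LinearMaps.

Variable R : comPzRingType.
Implicit Types A B Q V : lmodType R.

(** A linear relation in which 0 is related only to 0 is single-valued, so any choice function for
    it is linear. Maps defined through chosen lifts are built this way. *)
Lemma linear_of_relation A B (G : A -> B -> Prop) :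
    (forall x, exists u, G x u) ->
    (forall a x y u v, G x u -> G y v -> G (a *: x + y) (a *: u + v)) ->
    (forall u, G 0 u -> u = 0) ->
  exists f : {linear A -> B}, forall x, G x (f x).
Proof.
move=> /choice[f fG] Glin G0.
have f_lin : linear f.
  move=> a x y; apply/esym/eqP.
  rewrite -subr_eq0 [X in X == _]addrC -scaleN1r; apply/eqP/G0.
  (* By linearity, [G] relates 0 to the defect of linearity of [f]. *)
  rewrite -[X in G X _](addNr (a *: x + y)) -[X in G (X + _)]scaleN1r.
  by apply: (Glin) => //; apply: Glin.
by exists (to_linear f_lin).
Qed.

Lemma image_exists A B (f : {linear A -> B}) :
  exists (I : lmodType R) (p : {linear A -> I}) (i : {linear I -> B}),
    [/\ surjective p, injective i & forall x, f x = i (p x)].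
Proof.
have [] := @submodule_exists R B (fun y => exists x, f x = y).
  split=> [|a _ _ [x <-] [y <-]]; first by exists 0; rewrite linear0.
  by exists (a *: x + y); rewrite linearP.
move=> I [i [i_inj iE]].
have [||u|p pE] := @linear_of_relation A I (fun x u => f x = i u).
- by move=> x; case: (iffLR (iE (f x))) => [|u <-]; [exists x | exists u].
- by move=> a x y u v fx fy; rewrite !linearP fx fy.
- by rewrite linear0 => iu; apply: i_inj; rewrite -iu linear0.
exists I, p, i; split=> // u.
have /iE[x fx] : exists w, i w = i u by exists u.
by exists x; apply: i_inj; rewrite -pE.
Qed.

Lemma kernel_exists A B (f : {linear A -> B}) :
  exists (K : lmodType R) (i : {linear K -> A}), is_kernel f i.
Proof.
have [|K [i [i_inj iE]]] := @submodule_exists R A (fun x => f x = 0).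
  by split=> [|a x y fx fy]; rewrite ?linear0 // linearP fx fy scaler0 addr0.
by exists K, i.
Qed.

Lemma cokernel_exists A B (f : {linear A -> B}) :
  exists (Q : lmodType R) (p : {linear B -> Q}), is_cokernel f p.
Proof.
have [|Q [p [p_surj pE]]] := @quotient_exists R B (fun y => exists x, f x = y).
  split=> [|a _ _ [x <-] [y <-]]; first by exists 0; rewrite linear0.
  by exists (a *: x + y); rewrite linearP.
by exists Q, p.
Qed.

Lemma linear_rV_sum n A (f : {linear 'rV[R]_n -> A}) v :
  f v = \sum_i v 0 i *: f (delta_mx 0 i).
Proof.
rewrite {1}[v]row_sum_delta linear_sum.
by apply: eq_bigr => i _; rewrite linearZ.
Qed.

Lemma linear_rV_of_basis n A (a : 'I_n -> A) :
  exists f : {linear 'rV[R]_n -> A}, forall v, f v = \sum_i v 0 i *: a i.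
Proof.
have f_lin : linear (fun v : 'rV[R]_n => \sum_i v 0 i *: a i).
  move=> c u v; rewrite scaler_sumr -big_split; apply: eq_bigr => i _ /=.
  by rewrite !mxE scalerDl scalerA.
by exists (to_linear f_lin).
Qed.

Lemma linear_rV_lift n A Q (p : {linear A -> Q}) (f : {linear 'rV[R]_n -> Q}) :
  surjective p -> exists g : {linear 'rV[R]_n -> A}, forall v, p (g v) = f v.
Proof.
move=> p_surj; have [a aE] := choice (fun i => p_surj (f (delta_mx 0 i))).
have [g gE] := linear_rV_of_basis a; exists g => v.
rewrite gE linear_rV_sum linear_sum; apply: eq_bigr => i _.
by rewrite linearZ aE.
Qed.

Lemma linear_copair m n A (f : {linear 'rV[R]_m -> A})
    (g : {linear 'rV[R]_n -> A}) :
  exists h : {linear 'rV[R]_(m + n) -> A},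
    forall v w, h (row_mx v w) = f v + g w.
Proof.
have h_lin : linear (fun v : 'rV[R]_(m + n) => f (lsubmx v) + g (rsubmx v)).
  by move=> c u v; rewrite !linearP scalerDr addrACA.
by exists (to_linear h_lin) => v w /=; rewrite row_mxKl row_mxKr.
Qed.

End LinearMaps.

(** * Modules whose finitely generated submodules are finitely presented *)

Section CoherentModules.

Variable R : comPzRingType.
Implicit Types A B E K V Q : lmodType R.

(** Finite generation of [A] itself is left out (pseudo-coherence), so that the property passes to
    all submodules. *)
Definition coherent_module A : Prop :=
  forall n (f : {linear 'rV[R]_n -> A}),
    exists m (g : {linear 'rV[R]_m -> 'rV[R]_n}), exact_at g f.

Lemma finitely_generated_quotient A Q (p : {linear A -> Q}) :
  surjective p -> finitely_generated A -> finitely_generated Q.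
Proof.
move=> p_surj [n [f f_surj]]; exists n, (p \o f) => y.
by have [x <-] := p_surj y; have [w <-] := f_surj x; exists w.
Qed.

Lemma finitely_presented_fg A : finitely_presented A -> finitely_generated A.
Proof. by move=> [m [n [f [p [_ p_surj]]]]]; exists n, p. Qed.

Lemma coherent_finitely_presented A :
  finitely_generated A -> coherent_module A -> finitely_presented A.
Proof. by move=> [n [p ?]] /(_ n p)[m [f ?]]; exists m, n, f, p. Qed.

Lemma coherent_sub A V (i : {linear A -> V}) :
  injective i -> coherent_module V -> coherent_module A.
Proof.
move=> i_inj cohV n f; have [m [g gE]] := cohV n (i \o f).
exists m, g => y; rewrite -gE /=; split=> [->|]; first by rewrite linear0.
by rewrite -[X in _ = X](linear0 i) => /i_inj.
Qed.

(** Lift [f] to f' : R^n -> A. The kernel of [f] is the projection to R^n of the kernel of (f', h) :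
    R^(n+k) -> A. *)
Lemma coherent_quotient A Q k (h : {linear 'rV[R]_k -> A})
    (p : {linear A -> Q}) :
  surjective p -> exact_at h p -> coherent_module A -> coherent_module Q.
Proof.
move=> p_surj hp cohA n f; have [f' f'E] := linear_rV_lift f p_surj.
have [F FE] := linear_copair f' h; have [m [g gE]] := cohA _ F.
exists m, (lsubmx \o g) => y; split=> [fy|[w <-]] /=.
  have /hp[x hx] : p (f' y) = 0 by rewrite f'E.
  have /gE[w gw] : F (row_mx y (- x)) = 0 by rewrite FE linearN hx subrr.
  by exists w; rewrite /= gw row_mxKl.
have /gE : exists x, g x = g w by exists w.
rewrite -[X in F X]hsubmxK FE => /eqP; rewrite addr_eq0 => /eqP f'w.
by rewrite -f'E f'w linearN (iffRL (hp _)) ?oppr0 //; eexists.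
Qed.

(** The hypothesis embeds [E] into B x A. Generate the kernel of p f by [g], then the kernel of q f
    g by [h]; g h generates the kernel of [f]. *)
Lemma coherent_embed2 A B E (p : {linear E -> B}) (q : {linear E -> A}) :
    (forall v, p v = 0 -> q v = 0 -> v = 0) ->
  coherent_module A -> coherent_module B -> coherent_module E.
Proof.
move=> pq0 cohA cohB n f; have [m [g gE]] := cohB _ (p \o f).
have [l [h hE]] := cohA _ (q \o (f \o g)).
exists l, (g \o h) => y; split=> [fy|[w <-]] /=.
  have /gE[w gw] : (p \o f) y = 0 by rewrite /= fy linear0.
  have /hE[u hu] : (q \o (f \o g)) w = 0 by rewrite /= gw fy linear0.
  by exists u; rewrite /= hu.
apply: pq0; first by apply/gE; exists (h w).
by apply/(hE (h w)); exists w.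
Qed.

(* With q a finitely presented cover, w lifting p through q and u lifting q
   through p, the kernel of p is u (ker q) + im (1 - u w).                   *)
Lemma finitely_presented_kernel A n (p : {linear 'rV[R]_n -> A}) :
    finitely_presented A -> surjective p ->
  exists m (g : {linear 'rV[R]_m -> 'rV[R]_n}), exact_at g p.
Proof.
move=> [m [k [f [q [fq q_surj]]]]] p_surj.
have [u uE] := linear_rV_lift q p_surj.
have [w wE] := linear_rV_lift p q_surj.
have d_lin : linear (fun v => v - u (w v)).
  by move=> a x y; rewrite (linearP w) (linearP u) opprD addrACA scalerBr.
have [g gE] := linear_copair (u \o f) (to_linear d_lin).
exists (m + n)%N, g => v; split=> [pv|[x <-]].
  have /fq[z fz] : q (w v) = 0 by rewrite wE.
  by exists (row_mx z v); rewrite gE /= fz addrC subrK.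
rewrite -[x]hsubmxK gE /= !linearD linearN !uE wE subrr addr0.
by apply/fq; eexists.
Qed.

(** A cover p : R^n -> A maps the kernel of f p, which is finitely generated, onto the kernel of
    [f]. *)
Lemma kernel_fg A B K (f : {linear A -> B}) (i : {linear K -> A}) :
    is_kernel f i -> finitely_generated A -> coherent_module B ->
  finitely_generated K.
Proof.
move=> [i_inj iE] [n [p p_surj]] cohB; have [m [g gE]] := cohB _ (f \o p).
have [||v|h hE] := @linear_of_relation R _ _ (fun x u => p (g x) = i u).
- move=> x; have /iE[u <-] : f (p (g x)) = 0 by apply/(gE (g x)); exists x.
  by exists u.
- by move=> a x y u v Gx Gy; rewrite !linearP Gx Gy.
- by rewrite !linear0 => iv; apply: i_inj; rewrite -iv linear0.
exists m, h => u; have [v pv] := p_surj (i u).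
have /gE[w gw] : (f \o p) v = 0 by rewrite /= pv; apply/iE; exists u.
by exists w; apply: i_inj; rewrite -hE gw.
Qed.

End CoherentModules.

(** * Finitely presented modules over a coherent ring *)

Section OverCoherentRing.

Variable R : comPzRingType.
Hypothesis coherentR : coherent R.
Implicit Types A B K M Q W : lmodType R.

(** The image of [f] is a finitely generated ideal, hence finitely presented, so the kernel of its
    cover by R^n is finitely generated. *)
Lemma coherent_regular_module : coherent_module R^o.
Proof.
move=> n f; have [I [p [i [p_surj i_inj fE]]]] := image_exists f.
have [|m [g gE]] := @finitely_presented_kernel R I n p _ p_surj.
  by apply: coherentR; [exists i | exists n, p].
exists m, g => v; rewrite -gE fE; split=> [|->]; last by rewrite linear0.
by rewrite -[X in _ = X](linear0 i) => /i_inj.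
Qed.

Lemma coherent_rV n : coherent_module 'rV[R]_n.
Proof.
elim: n => [|n IHn].
  move=> m f; exists m, idfun => y; split=> [_|_]; first by exists y.
  by apply/rowP=> -[].
have q_lin : linear (fun v : 'rV[R]_(1 + n) => lsubmx v 0 0 : R^o).
  by move=> a x y; rewrite !mxE.
apply: (@coherent_embed2 _ _ _ _ (@rsubmx R 1 1 n) (to_linear q_lin)) => //.
  move=> v v2 v1; rewrite -[v]hsubmxK v2.
  suff -> : lsubmx v = 0 by rewrite row_mx0.
  by apply/rowP=> i; rewrite ord1 [RHS]mxE.
exact: coherent_regular_module.
Qed.

Lemma finitely_presented_coherent A :
  finitely_presented A -> coherent_module A.
Proof.
move=> [m [n [f [p [fp p_surj]]]]].
exact: coherent_quotient p_surj fp (@coherent_rV n).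
Qed.

Lemma finitely_presented_kernel_map A B K (f : {linear A -> B})
    (i : {linear K -> A}) :
    finitely_presented A -> finitely_presented B -> is_kernel f i ->
  finitely_presented K.
Proof.
move=> fpA fpB fi; apply: coherent_finitely_presented.
  apply: kernel_fg fi _ _; first exact: finitely_presented_fg.
  exact: finitely_presented_coherent.
by case: fi => /coherent_sub subB _; apply/subB/finitely_presented_coherent.
Qed.

Lemma finitely_presented_cokernel A B Q (f : {linear A -> B})
    (p : {linear B -> Q}) :
    finitely_presented A -> finitely_presented B -> is_cokernel f p ->
  finitely_presented Q.
Proof.
move=> fpA fpB [p_surj fp]; apply: coherent_finitely_presented.
  exact: finitely_generated_quotient p_surj (finitely_presented_fg fpB).
have [n [h h_surj]] := finitely_presented_fg fpA.
apply: (@coherent_quotient _ _ _ _ (f \o h)) p_surj _ _.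
  move=> y; rewrite fp; split=> [[x <-]|[x <-]]; last by exists (h x).
  by have [w <-] := h_surj x; exists w.
exact: finitely_presented_coherent.
Qed.

End OverCoherentRing.

(** * Cokernels of finite families of maps *)

Section FiniteCokernels.

Variable R : comPzRingType.
Implicit Types A B M Q W : lmodType R.

Lemma scale_is_linear (a : R) M : linear (fun x : M => a *: x).
Proof. by move=> b x y; rewrite scalerDr !scalerA mulrC. Qed.

Definition scale_map (a : R) M : {linear M -> M} :=
  to_linear (@scale_is_linear a M).

(** Taking the cokernels one after another divides [B] by the sum of the images without forming a
    direct sum. The last clause says that the kernel of [p] is no larger than that sum. The class
    [D] will be either [C] or the finitely presented modules. *)
Lemma cokernel_family (D : lmodType R -> Prop) A B (P : seq R)
    (e : R -> {linear A -> B}) :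
    (forall A' B' Q (f : {linear A' -> B'}) (p : {linear B' -> Q}),
       D A' -> D B' -> is_cokernel f p -> D Q) ->
    D A -> D B ->
  exists Q (p : {linear B -> Q}),
    [/\ D Q, surjective p, forall s x, s \in P -> p (e s x) = 0
      & forall U, submodule_pred U -> (forall s x, s \in P -> U (e s x)) ->
        forall y, p y = 0 -> U y].
Proof.
move=> Dcoker DA DB; elim: P => [|a P [Q [p [DQ p_surj pe pmin]]]].
  by exists B, idfun; split=> [|y||U [U0 _] _ y /= ->] //; exists y.
have [Q' [q [q_surj qE]]] := cokernel_exists (p \o e a).
exists Q', (q \o p); split=> [|y|s x|U Usub Ue y /= /qE[x /= pex]].
- exact: Dcoker DA DQ (conj q_surj qE).
- by have [u <-] := q_surj y; have [x <-] := p_surj u; exists x.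
- rewrite inE => /predU1P[->|sP] /=; last by rewrite pe ?linear0.
  by apply/qE; exists x.
- rewrite -[y](addrNK (e a x)) addrC -[e a x]scale1r; apply: (proj2 Usub).
    by apply: Ue; rewrite mem_head.
  apply: (pmin) => // [s x' sP|]; first by apply: Ue; rewrite inE sP orbT.
  by rewrite linearB /= scale1r pex subrr.
Qed.

End FiniteCokernels.

(** * Wide subcategories and good lists *)

Definition kills (R : comPzRingType) (P : seq R) (W : lmodType R) : Prop :=
  forall a (w : W), a \in P -> a *: w = 0.

Section WideSubcategory.

Variable R : comPzRingType.
Hypothesis coherentR : coherent R.
Variable C : lmodType R -> Prop.
Hypothesis wideC : wide C.
Implicit Types A B M N Q W Z : lmodType R.
Implicit Types P J : seq R.

Definition good P : Prop :=
  forall W, finitely_presented W -> kills P W -> C W.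

Definition ideal_mul P J : seq R := [seq a * b | a <- P, b <- J].

(** [W] is an extension of W/JW, killed by [J], by JW, killed by [P]; coherence makes both finitely
    presented. *)
Lemma good_mul P J : good P -> good J -> good (ideal_mul P J).
Proof.
move=> goodP goodJ W fpW killsW.
have [Q [p [fpQ p_surj pJ pmin]]] := cokernel_family J
  (@scale_map R ^~ W) (finitely_presented_cokernel coherentR) fpW fpW.
have [K [i iK]] := kernel_exists p.
apply: (wide_extension wideC (i := i) (p := p)); last by case: iK.
  apply: goodP => [|a x aP].
    exact: finitely_presented_kernel_map fpW fpQ iK.
  have [i_inj iE] := iK; apply: i_inj; rewrite linear0 linearZ /=.
  (* The elements killed by [a] form a submodule containing every b W with [b] in [J], hence
     containing JW. *)
  apply: (pmin (fun w => a *: w = 0)).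
  - split=> [|b u v au av]; first exact: scaler0.
    by rewrite (linearP (scale_map a W)) /= au av scaler0 addr0.
  - by move=> b w bJ /=; rewrite scalerA; apply: killsW; apply: allpairs_f.
  - by apply/iE; exists x.
apply: goodJ => // b y bJ; have [w <-] := p_surj y.
by rewrite -linearZ; apply: pJ.
Qed.

(** A zero module is the kernel of the identity of [M]. *)
Lemma wide_zero M W : C M -> (forall w : W, w = 0) -> C W.
Proof.
move=> CM W0.
have z_lin : linear (fun _ : W => 0 : M).
  by move=> a x y; rewrite scaler0 addr0.
apply: (wide_kernel wideC (f := idfun) (i := to_linear z_lin) CM CM).
split=> [x y _|y]; first by rewrite (W0 x) (W0 y).
by split=> [/= ->|[x <-]] //; exists 0.
Qed.

(** [Zn] is Z^n, an iterated extension of copies of [Z], and [pi] sends v to the family of the v_i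
    z. If [z] generates [Z], this is the reduction of R^n modulo ann z. *)
Lemma wide_power Z (z : Z) n : C Z ->
  exists (Zn : lmodType R) (pi : {linear 'rV[R]_n -> Zn}),
    [/\ C Zn, (forall y : Z, exists r, r *: z = y) -> surjective pi
      & forall v, pi v = 0 <-> forall i, v 0 i *: z = 0].
Proof.
move=> CZ; elim: n => [|n [Zn [pi [CZn pi_surj piE]]]].
  exists 'rV[R]_0, idfun; split=> [|_ y|v].
  - by apply: wide_zero CZ _ => w; apply/rowP=> -[].
  - by exists y.
  - by split=> _; [case | apply/rowP=> -[]].
have pi'_lin : linear (fun v : 'rV[R]_(1 + n) =>
    (lsubmx v 0 0 *: z, pi (rsubmx v)) : (Z * Zn)%type).
  move=> a u v; rewrite !linearP !mxE /=; congr (_, _).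
  by rewrite scalerDl -scalerA.
have i_lin : linear (fun x : Z => (x, 0) : (Z * Zn)%type).
  by move=> a x y; congr (_, _); rewrite /= scaler0 addr0.
exists (Z * Zn)%type, (to_linear pi'_lin); split=> [|z_gen [x y]|v].
- apply: (wide_extension wideC (i := to_linear i_lin) (p := snd)) CZ CZn _.
  split=> [x y [] //|[x y]|y]; last by exists (0, y).
  by split=> [/= ->|[w [_ <-]]] //; exists x.
- have [r <-] := z_gen x; have [w <-] := pi_surj z_gen y.
  by exists (row_mx r%:M w); rewrite /= row_mxKl row_mxKr mxE eqxx.
- move: v; rewrite -[n.+1]/(1 + n)%N => v /=.
  rewrite -[v]hsubmxK row_mxKl row_mxKr; split.
    move=> [v0 /piE v1] i; rewrite mxE; case: split_ordP => j _ //.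
    by rewrite ord1.
  move=> vz; congr (_, _); first by have := vz (lshift n 0); rewrite row_mxEl.
  by apply/piE => i; have := vz (rshift 1 i); rewrite row_mxEr.
Qed.

(* If Z = R z is isomorphic to R/J, a presentation of W by R^m -> R^n
   becomes, after tensoring with R/J, a presentation by Z^m -> Z^n.          *)
Lemma wide_killed_by_annihilator Z (z : Z) W :
    C Z -> (forall y : Z, exists r, r *: z = y) ->
    finitely_presented W ->
    (forall r (w : W), r *: z = 0 -> r *: w = 0) ->
  C W.
Proof.
move=> CZ z_gen [m [n [f [p [fp p_surj]]]]] zW.
have [Zm [pim [CZm /(_ z_gen) pim_surj pimE]]] := wide_power z m CZ.
have [Zn [pin [CZn /(_ z_gen) pin_surj pinE]]] := wide_power z n CZ.
(* A map vanishing on the kernel of a surjection factors through it. *)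
have descend (k : nat) (Zk B : lmodType R) (pik : {linear 'rV[R]_k -> Zk})
    (g : {linear 'rV[R]_k -> B}) : surjective pik ->
    (forall v, pik v = 0 -> g v = 0) ->
    exists h : {linear Zk -> B}, forall v, h (pik v) = g v.
  move=> pik_surj pikg.
  have [x|a x y _ _ [v <- <-] [w <- <-]|_ [v /pikg-> <-//]|h hE] :=
      @linear_of_relation R _ _ (fun x y => exists2 v, pik v = x & g v = y).
  - by have [v <-] := pik_surj x; exists (g v), v.
  - by exists (a *: v + w); rewrite linearP.
  exists h => v; have [w ww <-] := hE (pik v).
  apply/eqP; rewrite -subr_eq0 -linearB; apply/eqP/pikg.
  by rewrite linearB ww subrr.
(* By commutativity, [f] sends vectors with coordinates in ann z to vectors of the same kind. *)
have [v /pimE vz|fZ fZE] := descend _ _ _ _ (pin \o f) pim_surj.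
  rewrite /= (linear_rV_sum f) linear_sum big1 // => i _.
  apply/pinE => j.
  by rewrite mxE mulrC -scalerA vz scaler0.
have [v /pinE vz|pZ pZE] := descend _ _ _ _ p pin_surj.
  by rewrite linear_rV_sum big1 // => i _; apply: zW.
apply: (wide_cokernel wideC (f := fZ) (p := pZ)) CZm CZn _.
split=> [w|y].
  by have [v <-] := p_surj w; exists (pin v); rewrite pZE.
have [v <-] := pin_surj y; rewrite pZE fp; split=> [[u <-]|[x]].
  by exists (pim u); rewrite fZE.
have [u <-] := pim_surj x; rewrite fZE => /= fu.
(* The coordinates of v - f u lie in ann z, which kills [W]; hence [p] kills v - f u. *)
have /pinE vz : pin (v - f u) = 0 by rewrite linearB fu subrr.
apply/fp; rewrite -[v](subrK (f u)) linearD.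
rewrite (iffRL (fp (f u))) ?addr0; last by exists u.
by rewrite linear_rV_sum big1 // => i _; apply: zW.
Qed.

(* I generates the ideal (h(R^k) : y): that r lies in the ideal generated by I
   is expressed by r killing every module that I kills.                      *)
Lemma colon_finitely_generated k M (h : {linear 'rV[R]_k -> M}) (y : M) :
    coherent_module M ->
  exists I : seq R, (forall a, a \in I -> exists u, a *: y = h u) /\
    forall r u, r *: y = h u ->
      forall W, kills I W -> forall w : W, r *: w = 0.
Proof.
move=> cohM.
have y_lin : linear (fun v : 'rV[R]_1 => v 0 0 *: y).
  by move=> a u v; rewrite !mxE scalerDl scalerA.
have [F FE] := linear_copair (to_linear y_lin) h.
(* The kernel of F(r, w) = r y + h w is finitely generated; the first coordinates of its generators
   generate the colon ideal. *)
have [m [g gE]] := cohM _ F.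
exists [seq g (delta_mx 0 i) 0 (lshift k 0) | i : 'I_m]; split.
  move=> _ /imageP[i _ ->]; set x := g _.
  have /gE : exists w, g w = x by exists (delta_mx 0 i).
  rewrite -{1}[x]hsubmxK FE /= !mxE => /eqP; rewrite addr_eq0 => /eqP->.
  by exists (- rsubmx x); rewrite linearN.
move=> r u ry W killsW w.
have /gE[x gx] : F (row_mx r%:M (- u)) = 0.
  by rewrite FE /= mxE eqxx linearN mulr1n ry subrr.
have -> : r = g x 0 (lshift k 0) by rewrite gx row_mxEl mxE eqxx.
rewrite linear_rV_sum summxE scaler_suml big1 // => i _.
rewrite !mxE -scalerA [X in _ *: X]killsW ?scaler0 //.
by apply: (map_f (fun i => g (delta_mx 0 i) 0 (lshift k 0))); rewrite mem_enum.
Qed.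

Hypothesis C_fp : forall M, C M -> finitely_presented M.

(* With L = h(R^k) and I = (L : y), each s in P yields a map M -> M/IM sending
   m to r y where s m = r y modulo L. The sum N of the images lies in C and in
   R y, and R y is an extension of R y / N, which is killed by P, by N. Hence
   R y is in C, so J = (IM : y) is good, and P J y <= L.                     *)
Lemma good_eliminate_generator k M (h : {linear 'rV[R]_k -> M}) (y : M) P :
    C M -> good P ->
    (forall a m, a \in P -> exists r v, a *: m = r *: y + h v) ->
  exists P', good P' /\ forall a m, a \in P' -> exists v, a *: m = h v.
Proof.
move=> CM goodP PM.
have cohC A : C A -> coherent_module A.
  by move=> /C_fp; apply: finitely_presented_coherent.
have [I [Iy Icolon]] := colon_finitely_generated h y (cohC M CM).
have [B [p [CB p_surj pI pmin]]] :=
  cokernel_family I (@scale_map R ^~ M) (wide_cokernel wideC) CM CM.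
have killsB : kills I B.
  move=> a b aI; have [m <-] := p_surj b.
  by rewrite -linearZ; apply: pI.
pose U m := forall a, a \in P -> exists v, a *: m = h v.
(* P I M <= L: for [b] in [P] and [a] in [I], b x = r y + h v gives b a x = r (a y) + a h v, and a y
   is in L. *)
have pU m : p m = 0 -> U m.
  apply: pmin => [|a x aI b bP]; first split.
  - by move=> a _; exists 0; rewrite scaler0 linear0.
  - move=> c u v Uu Uv a aP.
    have [u' uE] := Uu a aP; have [v' vE] := Uv a aP.
    exists (c *: u' + v'); rewrite (linearP h) -uE -vE scalerDr !scalerA.
    by rewrite mulrC.
  - have [r [v bx]] := PM b x bP; have [u au] := Iy a aI.
    exists (r *: u + a *: v).
    rewrite /= scalerA mulrC -scalerA bx scalerDr (linearP h).
    by rewrite [h (a *: v)]linearZ /= -au !scalerA [r * a]mulrC.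
(* The value r p(y) is well defined: if r y + h v = 0 then [r] is in (L : y), which kills [B].
   Outside [P] the map is a dummy zero. *)
have /choice[e eE] s : exists e : {linear M -> B}, s \in P ->
    forall m, exists r v, s *: m = r *: y + h v /\ e m = r *: p y.
  have [sP|_] := boolP (s \in P); last by exists (\0 : {linear M -> B}).
  have [m|c m m' _ _ [r [v [mE ->]]] [r' [v' [m'E ->]]]
    |b [r [v [rv ->]]]|e eE] :=
    @linear_of_relation R _ _ (fun m b => exists r v,
      s *: m = r *: y + h v /\ b = r *: p y).
  - by have [r [v mE]] := PM s m sP; exists (r *: p y), r, v.
  - exists (c * r + r'), (c *: v + v'); split.
      rewrite (linearP h) scalerDr scalerA mulrC -scalerA mE m'E.
      by rewrite scalerDl scalerDr scalerA addrACA.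
    by rewrite scalerDl scalerA.
  - apply: (Icolon r (- v)) => //.
    by apply/eqP; rewrite linearN -addr_eq0 -rv scaler0.
  by exists e => _ m; have [r [v [mE em]]] := eE m; exists r, v.
(* From s y = r y + h v, the scalar s - r is in (L : y) and kills [B]. So s p(y) is in the image of
   e s, which will make [P] kill the quotient [T]. *)
have ey s : s \in P -> e s y = s *: p y.
  move=> sP; have [r [v [sy ->]]] := eE s sP y.
  apply/eqP; rewrite eq_sym -subr_eq0 -scalerBl; apply/eqP.
  by apply: (Icolon _ v) => //; rewrite scalerBl sy addrC addKr.
have [Q [q [CQ q_surj qe qmin]]] :=
  cokernel_family P e (wide_cokernel wideC) CM CB.
have q_ker b : q b = 0 -> exists r, r *: p y = b.
  apply: (qmin (fun b => exists r, r *: p y = b)) => [|s m sP].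
    split=> [|c _ _ [r <-] [r' <-]]; first by exists 0; rewrite scale0r.
    by exists (c * r + r'); rewrite scalerDl scalerA.
  by have [r [v [_ ->]]] := eE s sP m; exists r.
have y_lin : linear (fun v : 'rV[R]_1 => v 0 0 *: p y).
  by move=> a u v; rewrite !mxE scalerDl scalerA.
(* [Z] is R p(y) inside [B], [T] its image in [Q], and [N] the kernel of Z -> T. As the kernel of
   [q] lies in [Z], [N] is also the kernel of [q]. *)
have [Z [z [iZ [z_surj iZ_inj zE]]]] := image_exists (to_linear y_lin).
have [T [t [iT [t_surj iT_inj tE]]]] := image_exists (q \o iZ).
have [N [j [j_inj jE]]] := kernel_exists t.
have CN : C N.
  apply: (wide_kernel wideC (f := q) (i := iZ \o j)) CB CQ _.
  split=> [u v /iZ_inj/j_inj //|b]; split=> [qb|[u <-]].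
    have [r rb] := q_ker b qb.
    have iz : iZ (z r%:M) = b by rewrite -zE /= mxE eqxx.
    have /jE[u ju] : t (z r%:M) = 0.
      by apply: iT_inj; rewrite -tE /= iz qb linear0.
    by exists u; rewrite /= ju.
  have /= := tE (j u); rewrite (iffRL (jE (j u))) ?linear0 //.
  by exists u.
have CT : C T.
  apply: goodP => [|s x sP].
    apply: coherent_finitely_presented.
      apply: finitely_generated_quotient t_surj _.
      by exists 1, z.
    exact: coherent_sub iT_inj (cohC Q CQ).
  have [x' <-] := t_surj x; have [v <-] := z_surj x'.
  have qs : s *: q (p y) = 0 by rewrite -linearZ -[X in q X]ey // qe.
  apply: iT_inj; rewrite linear0 linearZ /= -tE /= -zE /= linearZ /= scalerA.
  by rewrite mulrC -scalerA qs scaler0.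
have CZ : C Z by apply: (wide_extension wideC (i := j) (p := t)) CN CT _.
have iz r : iZ (r *: z 1%:M) = r *: p y.
  by rewrite linearZ /= -zE /= mxE eqxx scale1r.
have z_gen (x : Z) : exists r, r *: z 1%:M = x.
  have [v <-] := z_surj x; exists (v 0 0).
  by apply: iZ_inj; rewrite iz -zE.
(* With the zero map from R^0, the colon ideal is the annihilator of p(y), that is (IM : y). *)
have [J [Jy Jann]] := colon_finitely_generated (\0 : {linear 'rV[R]_0 -> B})
  (p y) (cohC B CB).
have goodJ : good J.
  move=> W fpW killsW; apply: (wide_killed_by_annihilator CZ z_gen fpW).
  move=> r w rz; apply: (Jann r 0) => //.
  by rewrite -iz rz linear0.
(* The right factor takes [M] into R y + L, then [J] takes y into IM, and the left factor takes IM
   into L. *)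
exists (ideal_mul (ideal_mul P J) P); split.
  by do 2!apply: good_mul => //.
move=> _ m /allpairsP[[c a] /= [/allpairsP[[b j'] /= [bP jJ ->]] aP ->]].
have [r [v am]] := PM a m aP; have [u jy] := Jy j' jJ.
have /pU/(_ b bP)[w bjy] : p (j' *: y) = 0 by rewrite linearZ /= jy.
exists (r *: w + (b * j') *: v); rewrite -scalerA am scalerDr linearP -bjy.
rewrite [h (_ *: v)]linearZ /= !scalerA; congr (_ *: _ + _).
by rewrite mulrC mulrA.
Qed.

Lemma exists_good_annihilator M : C M -> exists P, good P /\ kills P M.
Proof.
move=> CM; have [n [p p_surj]] := finitely_presented_fg (C_fp CM).
have [P [goodP PM]] :
    exists P, good P /\ forall a m, a \in P -> exists v, a *: m = p v.
  (* A module killed by 1 is zero, so the list {1} is good. *)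
  exists [:: 1]; split=> [W _ W0|a m _].
    by apply: wide_zero CM _ => w; rewrite -[w]scale1r W0 ?mem_head.
  by have [v pv] := p_surj (a *: m); exists v.
(* Only the invariant that P M lies in the image of [p] survives the induction; for n = 0 it says
   that [P] kills [M]. *)
clear p_surj; elim: n p P goodP PM => [|n IHn] p P goodP PM.
  exists P; split=> // a m aP; have [v ->] := PM a m aP.
  by rewrite (_ : v = 0) ?linear0 //; apply/rowP=> -[].
move: p PM; rewrite -[n.+1]/(1 + n)%N => p PM.
have p'_lin : linear (fun v : 'rV[R]_n => p (row_mx (0 : 'rV_1) v)).
  move=> a u v; rewrite -linearP; congr (p _).
  by rewrite scale_row_mx add_row_mx scaler0 addr0.
(* The generator removed is the image of the first basis vector; the remaining span is the image of
   the last n coordinates. *)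
have [a m aP|P' [goodP' P'M]] := good_eliminate_generator
  (h := to_linear p'_lin) (y := p (row_mx (1%:M : 'rV_1) 0)) CM goodP.
  have [v ->] := PM a m aP; exists (v 0 0), (rsubmx v).
  rewrite -linearZ -linearD; congr (p _).
  rewrite scale_row_mx add_row_mx scaler0 addr0 add0r -[LHS]hsubmxK.
  congr (row_mx _ _); apply/rowP=> i.
  by rewrite !mxE ord1 eqxx mulr1; congr (v _ _); apply/val_inj.
exact: IHn goodP' P'M.
Qed.

Lemma wide_sub_or_quotient M N :
    C M -> finitely_presented N -> is_submodule N M \/ is_quotient N M ->
  C N.
Proof.
move=> CM fpN NM; have [P [goodP killsM]] := exists_good_annihilator CM.
apply: goodP => // a x aP; case: NM => [[i i_inj]|[p p_surj]].
  by apply: i_inj; rewrite linear0 linearZ /= killsM.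
by have [y <-] := p_surj x; rewrite -linearZ /= killsM ?linear0.
Qed.

End WideSubcategory.

(** * Finite generation over Noetherian rings *)

Lemma noetherian_rV (R : comPzRingType) n (U : 'rV[R]_n -> Prop) :
    noetherian R -> submodule_pred U ->
  exists m (g : {linear 'rV[R]_m -> 'rV[R]_n}),
    forall v, U v <-> exists w, g w = v.
Proof.
move=> noethR; elim: n U => [|n IHn] U [U0 UP].
  exists 0, idfun => v; split=> _; first by exists v.
  by rewrite (_ : v = 0) //; apply/rowP=> -[].
move: U U0 UP; rewrite -[n.+1]/(1 + n)%N => U U0 UP.
(* [U] is assembled from its vectors with first coordinate 0, handled by induction, and the ideal of
   its first coordinates. *)
have [|m [g gE]] := IHn (fun v => U (row_mx (0 : 'rV_1) v)).
  split=> [|a u v Uu Uv]; first by rewrite row_mx0.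
  by have := UP a _ _ Uu Uv; rewrite scale_row_mx add_row_mx scaler0 addr0.
have [|I [i [i_inj iE]]] :=
    @submodule_exists R R^o (fun r => exists v : 'rV_n, U (row_mx r%:M v)).
  split=> [|a r r' [v Uv] [v' Uv']]; first by exists 0; rewrite raddf0 row_mx0.
  exists (a *: v + v'); have := UP a _ _ Uv Uv'.
  by rewrite scale_row_mx add_row_mx scale_scalar_mx raddfD.
have [k [p p_surj]] : finitely_generated I by apply: noethR; exists i.
have [x|b bE] := @choice 'I_k 'rV[R]_n
    (fun x v => U (row_mx (i (p (delta_mx 0 x)))%:M v)).
  by apply/iE; exists (p (delta_mx 0 x)).
have [f fE] := @linear_rV_of_basis R k 'rV[R]_(1 + n)
  (fun x => row_mx (i (p (delta_mx 0 x)))%:M (b x)).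
have UZ a v : U v -> U (a *: v) by move=> Uv; rewrite -[_ *: _]addr0; apply: UP.
have UD u v : U u -> U v -> U (u + v).
  by move=> Uu Uv; rewrite -[u]scale1r; apply: UP.
have Uf u : U (f u).
  by rewrite fE; elim/big_ind: _ => // x _; apply: UZ.
have f0 u : lsubmx (f u) = (i (p u))%:M.
  rewrite fE (linear_rV_sum p) !linear_sum raddf_sum; apply: eq_bigr => x _.
  by rewrite !linearZ /= row_mxKl scale_scalar_mx.
have g'_lin : linear (fun w => row_mx (0 : 'rV[R]_1) (g w)).
  by move=> a u v; rewrite linearP scale_row_mx add_row_mx scaler0 addr0.
have [F FE] := linear_copair f (to_linear g'_lin).
exists (k + m)%N, F => v; split=> [Uv|[w <-]]; last first.
  by rewrite -[w]hsubmxK FE; apply: (UD) => //=; apply/gE; eexists.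
have /iE[s sE] : exists v' : 'rV_n, U (row_mx (lsubmx v 0 0)%:M v').
  by exists (rsubmx v); rewrite -mx11_scalar hsubmxK.
have [u pu] := p_surj s.
(* [f] sends the basis to lifts in [U] of generators of the ideal, so subtracting f u clears the
   first coordinate of v. *)
have vfu : row_mx 0 (rsubmx (v - f u)) = v - f u.
  rewrite -[RHS]hsubmxK; congr (row_mx _ _).
  by rewrite linearB /= f0 pu sE -mx11_scalar subrr.
have /gE[w gw] : U (row_mx 0 (rsubmx (v - f u))).
  by rewrite vfu addrC -scaleN1r; apply: UP.
by exists (row_mx u w); rewrite FE /= gw vfu addrC subrK.
Qed.

(** The preimage of [N] in R^n is finitely generated and maps onto [N]. *)
Lemma noetherian_sub_fg (R : comPzRingType) (M N : lmodType R) :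
    noetherian R -> finitely_generated M -> is_submodule N M ->
  finitely_generated N.
Proof.
move=> noethR [n [p p_surj]] [i i_inj].
have [|m [g gE]] :=
    @noetherian_rV R n (fun v => exists x, p v = i x) noethR.
  split=> [|a u v [x ux] [y vy]]; first by exists 0; rewrite !linear0.
  by exists (a *: x + y); rewrite !linearP ux vy.
have [x|a u v x y ux vy|x|f fE] :=
    @linear_of_relation R _ _ (fun u x => p (g u) = i x).
- by apply/(gE (g x)); exists x.
- by rewrite !linearP ux vy.
- by rewrite !linear0 => ix; apply: i_inj; rewrite -ix linear0.
exists m, f => x; have [v pv] := p_surj (i x).
have /gE[w gw] : exists x, p v = i x by exists x.
by exists w; apply: i_inj; rewrite -fE gw.
Qed.

Theorem corollary3p7 (R : comPzRingType) (hR : regular_coherent R) :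
  (forall C : lmodType R -> Prop,
     wide C -> (forall M : lmodType R, C M -> finitely_presented M) ->
     forall M : lmodType R, C M ->
     forall N : lmodType R, finitely_presented N ->
       is_submodule N M \/ is_quotient N M -> C N)
  /\ (noetherian R ->
      forall C : lmodType R -> Prop,
        wide C -> (forall M : lmodType R, C M -> finitely_generated M) ->
        serre C).
Proof.
have cohR : coherent R by case: hR.
split=> [C wideC C_fp M CM N|noethR C wideC C_fg].
  exact: wide_sub_or_quotient.
(* The kernel of a cover by R^n is a submodule of R^n, hence finitely generated. *)
have fg_fp (M : lmodType R) : finitely_generated M -> finitely_presented M.
  move=> [n [p p_surj]].
  have [|m [g gE]] := @noetherian_rV R n (fun v => p v = 0) noethR.
    by split=> [|a u v pu pv]; rewrite ?linear0 // linearP pu pv scaler0 addr0.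
  by exists m, n, g, p.
split=> // M N CM NM; apply: (wide_sub_or_quotient cohR wideC) (CM) _ _.
- by move=> M' /C_fg/fg_fp.
- by apply: fg_fp; apply: noetherian_sub_fg (C_fg M CM) NM.
- by left.
Qed.
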